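(* Let $G$ be a graph with countably infinite vertex set. Then $G$ has property FIN if and only if $\chi^*(G)=\infty$ and $G$ has no nonempty subgraph in which all degrees are infinite.
   Context: A labeling of the vertices of $G$ by $\mathbb{N}$ is a bijection $\phi:V(G)\to\mathbb{N}$; an increasing path is a path $v_1,v_2,\dots$ (finite or infinite) with $\phi(v_i)<\phi(v_{i+1})$. $G$ has property FIN if for every labeling of $V(G)$ by $\mathbb{N}$ and every $k\in\mathbb{N}$ there is an increasing path of length $k$, but there exists a labeling of $V(G)$ by $\mathbb{N}$ with no infinite increasing path. $\chi^*(G)$ is the minimum $k$ such that $V(G)$ can be partitioned into $k$ classes $V_1,\dots,V_k$ such that each $V_j$ is an independent set and each vertex of $V_j$ has only finitely many neighbours in $V_1\cup\dots\cup V_{j-1}$; if no such $k$ exists, $\chi^*(G)=\infty$. *)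

(* Defs.v *)
From mathcomp Require Import all_boot.
From mathcomp Require Import boolp classical_sets cardinality.

Set Implicit Arguments.
Unset Strict Implicit.
Unset Printing Implicit Defensive.

Local Open Scope classical_set_scope.

Record graph (V : Type) := Graph {
  adj : rel V;
  adj_sym : symmetric adj;
  adj_irr : irreflexive adj }.

Definition neighbours (V : Type) (G : graph V) (x : V) : set V :=
  [set y | adj G x y].

(** Subgraphs are not required to be induced. *)
Record subgraph (V : Type) (G : graph V) := Subgraph {
  sub_verts : set V;
  sub_adj : rel V;
  sub_adj_sym : symmetric sub_adj;
  sub_adjP : forall x y, sub_adj x y ->
    [/\ sub_verts x, sub_verts y & adj G x y] }.

Definition all_degrees_infinite (V : Type) (G : graph V) (H : subgraph G) :=
  forall x, sub_verts H x -> infinite_set [set y | sub_adj H x y].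

Definition labeling (V : Type) (phi : V -> nat) : Prop := bijective phi.

(** The finite path with vertex sequence [x :: p]; its length is the number
    of edges, [size p]. *)
Definition increasing_path (V : eqType) (G : graph V) (phi : V -> nat)
    (x : V) (p : seq V) : Prop :=
  [/\ uniq (x :: p), path (adj G) x p
    & path [rel u v | (phi u < phi v)%N] x p].

Definition infinite_increasing_path (V : Type) (G : graph V) (phi : V -> nat)
    (v : nat -> V) : Prop :=
  [/\ injective v, forall n, adj G (v n) (v n.+1)
    & forall n, (phi (v n) < phi (v n.+1))%N].

Definition FIN (V : eqType) (G : graph V) : Prop :=
  (forall phi : V -> nat, labeling phi ->
     forall k : nat, exists x p, increasing_path G phi x p /\ size p = k)
  /\ (exists phi : V -> nat,
        labeling phi /\ ~ exists v, infinite_increasing_path G phi v).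

Definition independent (V : Type) (G : graph V) (A : set V) : Prop :=
  forall x y, A x -> A y -> ~~ adj G x y.

(** The classes are indexed by [0, ..., k - 1]. *)
Definition chi_star_partition (V : Type) (G : graph V) (k : nat) : Prop :=
  exists F : nat -> set V,
    [/\ partition `I_k F [set: V],
        forall j, (j < k)%N -> independent G (F j)
      & forall j x, (j < k)%N -> F j x ->
          finite_set (neighbours G x `&` \bigcup_(i < j) F i)].

(** [None] stands for infinity. *)
Definition chi_star (V : Type) (G : graph V) : option nat :=
  if pselect (exists k, `[< chi_star_partition G k >]) is left exk
  then Some (ex_minn exk) else None.

(* Main.v *)
(** If a labeling has no increasing path of length [k], classifying vertices by
    the length of the longest increasing path ending there shows that [chi_star]
    is finite. Conversely, given a finite partition, each vertex has finitely many
    ancestors along edges directed from lower to higher classes, so there is a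
    labeling along which the class increases on increasing paths.

    A subgraph with infinite degrees contains an infinite increasing path for
    every labeling, by a greedy choice. If there is none, repeatedly eliminating
    the vertices with finitely many remaining neighbours exhausts the graph, which
    yields a well-order [lt] of the vertices in which each vertex has finitely many
    larger neighbours. Exhaust [V] by finite sets [P n], where [P n.+1] contains
    the larger neighbours of [P n] and is closed under the steps from [s] to a
    neighbour [w] with [s <= y < w] for some [y] in [P n] or among these larger
    neighbours: this closure is finite because along a chain of such steps the
    least admissible [y] strictly increases in a finite set. Label the blocks
    [P n.+1 \ P n] one after the other, each in decreasing order. An increasing
    path decreases inside a block, and if it enters a block through the edge
    [u, v], it leaves that block to a vertex smaller than [max u v]. So the maxima
    of the entry edges never increase, and every second one is smaller, which is
    impossible along an infinite increasing path. *)

Require Import Defs.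
From mathcomp Require Import all_boot.
From mathcomp Require Import boolp classical_sets cardinality.
From mathcomp Require Import wochoice.

Local Open Scope classical_set_scope.

(** * Well-orders and the transfinite elimination of vertices *)

Definition strict_total_order (T : eqType) (r : rel T) : Prop :=
  [/\ irreflexive r, transitive r & forall x y, x != y -> r x y || r y x].

(** [well_ordering_principle] gives unique least elements only, so the order axioms are read off
    from the least elements of sets of at most three points. *)
Lemma strict_well_order (T : eqType) :
  exists lt : rel T, strict_total_order T lt /\ well_founded lt.
Proof.
have [R woR] := well_ordering_principle T.
have min (A : {pred T}) a : a \in A ->
    exists2 m, m \in A & forall x, x \in A -> R m x.
  by move=> Aa; have [m [[Am mP] _]] := woR A (ex_intro _ a Aa); exists m.
have Rtot x y : R x y || R y x.
  have [m] := min (pred2 x y) x (predU1l _ erefl).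
  by rewrite !inE => /orP[]/eqP-> mP; rewrite mP ?orbT //= !inE eqxx ?orbT.
have Rxx x : R x x by have := Rtot x x; rewrite orbb.
have Ranti x y : R x y -> R y x -> x = y.
  move=> xy yx; have [m [_ mU]] := woR (pred2 x y) (ex_intro _ x (predU1l _ erefl)).
  rewrite -(mU x) ?(mU y) //; split; rewrite ?inE ?eqxx ?orbT // => z;
  by rewrite !inE => /orP[]/eqP->.
exists (fun x y => ~~ R y x); split; first split.
- by move=> x; rewrite /= Rxx.
- move=> y x z /= nyx nzy; apply/negP => zx.
  have [m] := min (mem [:: x; y; z]) x (mem_head _ _).
  rewrite !inE => /or3P[]/eqP-> mP.
  + have xz : R x z by apply: mP; rewrite !inE eqxx !orbT.
    move: nzy; rewrite (Ranti _ _ zx xz) mP //; by rewrite !inE eqxx orbT.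
  + by move: nyx; rewrite mP // mem_head.
  + by move: nzy; rewrite mP // !inE eqxx orbT.
- move=> x y /=; have /orP[xy|yx] := Rtot x y; rewrite -negb_and; apply: contra.
    by move=> /andP[yx _]; apply/eqP/Ranti.
  by move=> /andP[_ xy]; apply/eqP/Ranti.
- move=> x; apply: contrapT => nx.
  have [m] := min (mem [set y | ~ Acc (fun x y => ~~ R y x) y]) x (mem_set nx).
  rewrite inE /= => nm mP; apply: nm; constructor => y ym.
  by apply: contrapT => ny; move: ym; rewrite mP // inE.
Qed.

(* The vertices removed before stage [w] of the elimination, with the stages
   indexed by the well-order [lt]; [F] contains the neighbours of [x] that remain
   when [x] is removed. *)
Inductive eliminated (V W : eqType) (lt : rel W) (G : graph V) :
    W -> V -> Prop :=
  Eliminated w w' x (F : seq V) : lt w' w ->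
    (forall y, adj G x y -> y \notin F -> eliminated V W lt G w' y) ->
    eliminated V W lt G w x.

Lemma elimination_order (V : countType) (G : graph V) :
  ~ (exists H : subgraph G, sub_verts H !=set0 /\ all_degrees_infinite H) ->
  exists lt : rel V, [/\ strict_total_order V lt, well_founded lt
    & forall x, finite_set [set y | adj G x y /\ lt x y]].
Proof.
move=> noH.
have [ltW [[irr tr tot] wf]] := strict_well_order (set V).
pose E := eliminated V (set V) ltW G.
(* Otherwise the subgraph induced on the vertices remaining at stage [w] would have infinite
   degrees. *)
have next w : ~ (forall x, E w x) ->
    exists x, ~ E w x /\ forall w', ltW w w' -> E w' x.
  move=> /existsNP[x0 nx0]; apply: contrapT => nex; apply: noH.
  pose e x y := `[< [/\ adj G x y, ~ E w x & ~ E w y] >].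
  have es : symmetric e.
    by move=> x y; apply/asboolP/asboolP => -[]; rewrite adj_sym.
  have eP x y : e x y -> [/\ ~ E w x, ~ E w y & adj G x y].
    by move=> /asboolP[].
  exists (@Subgraph V G [set x | ~ E w x] e es eP); split; first by exists x0.
  move=> x /= nx /finite_seqP[F Fe]; apply: nex; exists x; split=> // w' ww'.
  apply: (@Eliminated _ _ _ _ _ w _ F) => // y xy; apply: contraNP => ny.
  have : [set y | e x y] y by apply/asboolP.
  by rewrite Fe.
have [w Ew] : exists w, forall x, E w x.
  apply: contrapT => /forallNP noE.
  have [f fP] := choice (fun w => next w (noE w)).
  have finj : injective f.
    move=> w w' fw; apply/eqP; apply: contraT => /tot /orP[] /[dup] lww'.
      by move/(proj2 (fP w)); rewrite fw; case: (fP w').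
    by move/(proj2 (fP w')); rewrite -fw; case: (fP w).
  pose D := [set x | exists A, f A = x /\ ~ A x].
  have nD : ~ D (f D) by move=> /[dup] DD [A [/finj->]].
  by apply: (nD); exists D.
have rk x : exists w, E w x /\ forall w', ltW w' w -> ~ E w' x.
  move: (Ew x); elim/(well_founded_ind wf): w {Ew} => w IH Ewx.
  have [[w' [w'w Ew']]|nw] := pselect (exists w', ltW w' w /\ E w' x).
    exact: (IH w').
  by exists w; split=> // w' w'w Ew'; apply: nw; exists w'.
have {w Ew rk} [r rP] := choice rk.
pose lt x y := ltW (r x) (r y) || (r x == r y) && (pickle x < pickle y).
have ltirr : irreflexive lt by move=> x; rewrite /lt irr ltnn andbF.
exists lt; split; first split=> //.
- move=> y x z; rewrite /lt => /orP[xy|/andP[/eqP<- xy]] /orP[yz|/andP[/eqP<- yz]].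
  + by rewrite (tr _ _ _ xy yz).
  + by rewrite xy.
  + by rewrite yz.
  + by rewrite eqxx (ltn_trans xy yz) orbT.
- move=> x y xy; rewrite /lt; have [rxy|/tot/orP[]->] := eqVneq (r x) (r y);
    rewrite ?orbT //.
  rewrite rxy irr /= -neq_ltn; apply: contra xy => /eqP pxy.
  exact/eqP/(pcan_inj pickleK).
- have wfl w n x : r x = w -> pickle x = n -> Acc lt x.
    elim/(well_founded_ind wf): w n x => w IHw n.
    elim/ltn_ind: n => n IHn x rx px; constructor => y.
    rewrite /lt rx px => /orP[yx|/andP[/eqP ry yx]]; first exact: IHw yx _ _ _ _.
    exact: IHn yx _ ry _.
  by move=> x; apply: wfl.
- move=> x; have [Ex minr] := rP x.
  (* A neighbour outside [F] is gone by stage [w'], so its rank is below that of [x]. *)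
  have [F [w' w'r EF]] : exists F : seq V, exists2 w', ltW w' (r x) &
      forall y, adj G x y -> y \notin F -> E w' y.
    by move: (r x) Ex => w Ex; case: Ex => {}w w' x' F w'w EF; exists F, w'.
  apply: (sub_finite_set _ (finite_seq F)) => y [xy ltxy] /=.
  apply: contraT => /(EF _ xy) Ey.
  have lyx : ltW (r y) (r x).
    have [->//|/tot/orP[|ryw']] := eqVneq (r y) w'.
      by move/tr; apply.
    by have [_ /(_ _ ryw')] := rP y.
  case/orP: ltxy => [/(tr _ _ _ lyx)|/andP[/eqP rxy _]]; first by rewrite irr.
  by move: lyx; rewrite rxy irr.
Qed.

(** * Labelings from finite blocks *)

(** In the lexicographic order each vertex has finitely many predecessors. Counting them embeds the
    order in [nat], and the embedding is onto since [V] is infinite. *)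
Lemma block_labeling (V : choiceType) (b : V -> nat) (r : rel V) :
  infinite_set [set: V] -> strict_total_order V r ->
  (forall n, finite_set [set x | b x <= n]) ->
  exists phi : V -> nat, labeling phi /\
    forall x y, phi x < phi y -> b x < b y \/ b x = b y /\ r x y.
Proof.
move=> infV [irr tr tot] finb.
pose L x y := (b x < b y) || (b x == b y) && r x y.
have Lirr x : L x x = false by rewrite /L ltnn irr andbF.
have Ltr : transitive L.
  move=> y x z; rewrite /L => /orP[xy|/andP[/eqP-> xy]] /orP[yz|/andP[/eqP<- yz]].
  - by rewrite (ltn_trans xy yz).
  - by rewrite xy.
  - by rewrite yz.
  - by rewrite eqxx (tr _ _ _ xy yz) orbT.
have Ltot x y : x != y -> L x y || L y x.
  by move=> /tot xy; rewrite /L; case: ltngtP.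
have below x : exists s : seq V, uniq s /\ forall y, (y \in s) = L y x.
  have /finite_seqP[s sE] : finite_set [set y | L y x].
    apply: sub_finite_set (finb (b x)) => y.
    by rewrite /L /= => /orP[/ltnW//|/andP[/eqP->]].
  exists (undup s); split=> [|y]; first exact: undup_uniq.
  rewrite mem_undup; apply/idP/idP => [ys|yx].
    by have : [set` s] y by []; rewrite -sE.
  by have : [set y | L y x] y by []; rewrite sE.
have {below} [s /all_and2[s_uniq sE]] := choice below.
pose phi x := size (s x).
have phiL x y : L x y -> phi x < phi y.
  move=> xy; have : {subset x :: s x <= s y}.
    move=> z; rewrite inE => /orP[/eqP->|]; rewrite !sE // => zx.
    exact: Ltr zx xy.
  by apply: uniq_leq_size; rewrite /= sE Lirr s_uniq.
have Lphi x y : phi x < phi y -> L x y.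
  move=> xy; have [xy'|/Ltot/orP[//|/phiL]] := eqVneq x y.
    by rewrite xy' ltnn in xy.
  by rewrite ltnNge ltnW.
have phiI : injective phi.
  move=> x y xy; apply/eqP; apply: contraT => /Ltot/orP[]/phiL;
  by rewrite xy ltnn.
have phiS n : exists x, phi x = n.
  have large : exists m, (n <= m) && `[< exists x, phi x = m >].
    apply: contrapT => noL; apply: infV.
    have -> : [set: V] = phi @^-1` `I_n.
      apply/seteqP; split=> x // _ /=.
      rewrite ltnNge; apply/negP => nx; apply: noL; exists (phi x).
      by rewrite nx; apply/asboolP; exists x.
    exact: finite_preimage (in2W phiI) (finite_II n).
  (* Predecessors of [x] have labels below [n] by the choice of [m], so there are at most [n] of
     them. *)
  case: (ex_minnP large) => m /andP[nm /asboolP[x xm]] mmin.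
  exists x; apply/eqP; rewrite eqn_leq xm nm andbT -xm.
  have : {subset map phi (s x) <= iota 0 n}.
    move=> _ /mapP[y + ->]; rewrite sE mem_iota add0n /= => /phiL yx.
    rewrite ltnNge; apply/negP => ny; move: yx; rewrite ltnNge xm mmin //.
    by rewrite ny; apply/asboolP; exists y.
  move=> /uniq_leq_size; rewrite size_iota size_map; apply.
  by rewrite map_inj_uniq.
exists phi; split.
  have [g gP] := choice phiS; exists g => // x.
  exact: phiI.
by move=> x y /Lphi /orP[]; [left|move=> /andP[/eqP]; right].
Qed.

(** * Finite closures under decreasing steps *)

(** By induction on the measure, [A] consists of [x] and one finite closed set for each of its
    finitely many successors. *)
Lemma finite_reachable (V : eqType) (R : V -> V -> Prop) (m : V -> nat) (x : V) :
  (forall v, finite_set [set w | R v w]) ->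
  (forall v w, R v w -> m w < m v) ->
  exists A : set V, [/\ finite_set A, A x & forall v w, A v -> R v w -> A w].
Proof.
move=> finR mR; have [n] := ubnP (m x); elim: n x => // n IHn x mx.
have rec w : exists A, R x w ->
    [/\ finite_set A, A w & forall u v, A u -> R u v -> A v].
  have [xw|nxw] := pselect (R x w); last by exists set0.
  have [|A AP] := IHn w; last by exists A.
  by apply: leq_trans (mR _ _ xw) _.
have [A AP] := choice rec.
exists (x |` \bigcup_(w in [set w | R x w]) A w); split.
- rewrite finite_setU; split; first exact: finite_set1.
  by apply: bigcup_finite => // w xw; case: (AP w xw).
- by left.
- move=> v w [->|[u xu Au]] vw; right.
    by exists w => //; case: (AP w vw).
  by exists u => //; case: (AP u xu) => _ _; apply; [exact: Au|].
Qed.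

Lemma count_lt (T : eqType) (p q : pred T) (y : T) (s : seq T) :
  subpred p q -> y \in s -> q y -> ~~ p y -> count p s < count q s.
Proof.
move=> pq + qy py; elim: s => // z s IHs; rewrite inE /= => /orP[/eqP<-|/IHs lt_s].
  by rewrite qy (negbTE py) add0n add1n ltnS sub_count.
by rewrite -addnS leq_add //; case pz: (p z); rewrite ?(pq z pz).
Qed.

(** * A labeling without infinite increasing paths *)

Section EliminationLabeling.

Variables (V : countType) (G : graph V) (lt : rel V).
Hypotheses (ltS : strict_total_order V lt) (ltwf : well_founded lt).
Hypothesis up_fin : forall x, finite_set [set y | adj G x y /\ lt x y].

Let lt_irr x : lt x x = false. Proof. by case: ltS => ->. Qed.

Let lt_trans : transitive lt. Proof. by case: ltS. Qed.

(* [~~ lt y x] stands for [x <= y]. *)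
Let le_lt_trans y x z : ~~ lt y x -> lt y z -> lt x z.
Proof.
case: ltS => _ _ tot nyx yz; have [->//|/tot/orP[xy|]] := eqVneq x y.
  exact: lt_trans xy yz.
by rewrite (negbTE nyx).
Qed.

Let le_trans y x z : ~~ lt y x -> ~~ lt z y -> ~~ lt z x.
Proof.
case: ltS => _ _ tot nyx; apply: contra => zx.
have [<-//|/tot/orP[|]] := eqVneq x y; first exact: lt_trans zx.
by rewrite (negbTE nyx).
Qed.

(** The measure of [v] counts the listed elements of [K] that are not below [v]. A step past [y]
    loses [y], and it has finitely many targets because it goes up. *)
Lemma finite_absorbing (K : set V) : finite_set K ->
  exists A : set V, [/\ finite_set A, K `<=` A &
    forall v w y, A v -> adj G v w -> K y -> ~~ lt y v -> lt y w -> A w].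
Proof.
move=> finK; pose R v w := adj G v w /\ exists y, [/\ K y, ~~ lt y v & lt y w].
have [F KF] := (finite_seqP _).1 finK.
have finR v : finite_set [set w | R v w].
  apply: sub_finite_set (up_fin v) => w [vw [y [_ vy yw]]]; split=> //.
  exact: le_lt_trans vy yw.
have mR v w : R v w ->
    count (fun y => ~~ lt y w) F < count (fun y => ~~ lt y v) F.
  move=> [vw [y [Ky vy yw]]]; apply: (count_lt _ _ _ y) => //.
  - move=> z; apply: le_trans; apply/negP => wv.
    by have := lt_trans _ _ _ (le_lt_trans _ _ _ vy yw) wv; rewrite lt_irr.
  - by move: Ky; rewrite KF.
  - by rewrite negbK.
have [A AP] := choice (fun x => finite_reachable _ R _ x finR mR).
exists (\bigcup_(k in K) A k); split.
- by apply: bigcup_finite => // k _; case: (AP k).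
- by move=> k Kk; exists k => //; case: (AP k).
- move=> v w y [k Kk Akv] vw Ky vy yw; exists k => //.
  by case: (AP k) => _ _; apply; [exact: Akv|split=> //; exists y].
Qed.

(* In the last clause, [y] is the maximum of [u] and [v]. *)
Lemma absorbing_filtration : exists P : nat -> set V,
  [/\ forall n, finite_set (P n), forall n, P n `<=` P n.+1,
      forall x, exists n, P n x
    & forall n u v s y w, P n u -> adj G u v -> P n.+1 s -> adj G s w ->
        (y = u \/ y = v) -> ~~ lt y u -> ~~ lt y v -> ~~ lt y s -> lt y w ->
        P n.+1 w].
Proof.
have step K : exists A : set V, finite_set K -> [/\ finite_set A, K `<=` A &
    forall v w y, A v -> adj G v w -> K y -> ~~ lt y v -> lt y w -> A w].
  have [/finite_absorbing[A AP]|nK] := pselect (finite_set K); first by exists A.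
  by exists set0.
have [A AP] := choice step.
(* With [up], the maximum of every edge starting in [P n] lies in [K n (P n)]; the vertex of index
   [n] ensures that the sets cover [V]. *)
pose up (B : set V) := \bigcup_(u in B) [set v | adj G u v /\ lt u v].
pose K n B := [set x | pickle x = n] `|` (B `|` up B).
pose P := fix P n := if n is n'.+1 then A (K n' (P n')) else set0.
have finK n B : finite_set B -> finite_set (K n B).
  move=> finB; rewrite !finite_setU; split; last first.
    by split=> //; apply: bigcup_finite.
  apply: (@finite_preimage _ _ [set n] pickle) => //.
  by move=> x y _ _; apply: (pcan_inj pickleK).
have finP n : finite_set (P n).
  by elim: n => //= n IHn; case: (AP _ (finK n _ IHn)).
have KP n : K n (P n) `<=` P n.+1 by case: (AP _ (finK n _ (finP n))).
exists P; split=> //.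
- by move=> n x Px; apply: KP; right; left.
- by move=> x; exists (pickle x).+1; apply: KP; left.
- move=> n u v s y w Pu uv Ps sw yuv yu yv ys yw.
  have [_ _ Acl] := AP _ (finK n _ (finP n)).
  apply: (Acl s w y) => //; right.
  case: yuv => yE; first by left; rewrite yE.
  have [<-|uy] := eqVneq u y; first by left.
  right; exists u => //; split; first by rewrite yE.
  by case: ltS => _ _ /(_ _ _ uy); rewrite (negbTE yu) orbF.
Qed.

Lemma elimination_labeling : infinite_set [set: V] ->
  exists phi : V -> nat,
    labeling phi /\ ~ exists v, infinite_increasing_path G phi v.
Proof.
move=> infV; have [P [finP PS Pcov Pcl]] := absorbing_filtration.
have Pmono m n : m <= n -> P m `<=` P n.
  by move=> /subnK<-; elim: (n - m) => // d IHd x /IHd /PS.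
have bex x : exists n, `[< P n x >].
  by have [n Pn] := Pcov x; exists n; apply/asboolP.
pose b x := ex_minn (bex x).
have bP x n : P n x <-> b x <= n.
  rewrite /b; case: ex_minnP => m /asboolP Pm mmin; split=> [Pn|mn].
    exact/mmin/asboolP.
  exact: Pmono mn _ Pm.
(* Reversing [lt] makes increasing paths descend inside a block. *)
pose r x y := lt y x.
have rS : strict_total_order V r.
  case: ltS => irr tr tot; split=> [x|y x z xy yz|x y /tot]; rewrite /r ?irr //.
    exact: tr yz xy.
  by rewrite orbC.
have finb n : finite_set [set x | b x <= n].
  by apply: sub_finite_set (finP n) => x /= /bP.
have [phi [phib phiP]] := block_labeling _ b r infV rS finb.
exists phi; split=> // -[v [vinj vadj vphi]].
have bS i : b (v i) <= b (v i.+1).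
  by have [/ltnW|[->]] := phiP _ _ (vphi i).
have bmono i d : b (v i) <= b (v (i + d)).
  elim: d => [|d IHd]; rewrite ?addn0 // addnS; exact: leq_trans (bS _).
pose entry i := b (v i) < b (v i.+1).
pose mx i := if lt (v i) (v i.+1) then v i.+1 else v i.
have mxE i : mx i = v i \/ mx i = v i.+1 by rewrite /mx; case: ifP; [right|left].
have mxl i : ~~ lt (mx i) (v i).
  rewrite /mx; case: ifP => [|_]; last by rewrite lt_irr.
  by move=> l; apply/negP => /(lt_trans _ _ _ l); rewrite lt_irr.
have mxr i : ~~ lt (mx i) (v i.+1).
  by rewrite /mx; case: ifP => [_|->]; rewrite ?lt_irr.
have block_exit i : exists d, b (v i) < b (v (i + d).+1).
  apply: contrapT => noex; apply: infinite_nat.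
  have -> : [set: nat] = v @^-1` [set x | b x <= b (v i)].
    apply/seteqP; split=> // j _ /=.
    rewrite leqNgt; apply/negP => bij; apply: noex; exists j.
    by apply: leq_trans bij _; rewrite -addSn addnC bmono.
  exact: finite_preimage (in2W vinj) (finb _).
have next_entry i : entry i ->
    exists j, [/\ entry j, ~~ lt (v i.+1) (v j) & lt (v j.+1) (mx i)].
  (* The next entry edge is the first exit from the block entered by edge [i]; [stay] follows the
     descent up to it. *)
  move=> ent; case: (ex_minnP (block_exit i.+1)) => d exit_d dmin.
  have stay e : e <= d ->
      b (v (i.+1 + e)) = b (v i.+1) /\ ~~ lt (v i.+1) (v (i.+1 + e)).
    elim: e => [|e IHe] ed; first by rewrite addn0 lt_irr.
    have [be le] := IHe (ltnW ed).
    have bE : b (v (i.+1 + e.+1)) = b (v i.+1).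
      apply/eqP; rewrite eqn_leq bmono andbT leqNgt addnS.
      by apply/negP => /dmin; rewrite leqNgt ed.
    rewrite addnS in bE *; split=> //; apply: le_trans _ _ _ le; apply/negP => cur.
    have := phiP _ _ (vphi (i.+1 + e)); rewrite be -bE ltnn /r.
    case=> // -[_ /(lt_trans _ _ _ cur)]; by rewrite lt_irr.
  have [bd ld] := stay d (leqnn d); exists (i.+1 + d); split=> //.
    by rewrite /entry bd.
  set j := i.+1 + d in exit_d bd ld *.
  (* If [v j.+1] were above [mx i], then [P n.+1] would absorb it, and the path would not leave the
     block here. *)
  have nlt : ~~ lt (mx i) (v j.+1).
    have [n bn] : exists n, b (v i.+1) = n.+1.
      by move: ent; rewrite /entry; case: (b (v i.+1)) => // n; exists n.
    apply/negP => lj.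
    have : P n.+1 (v j.+1).
      apply: (Pcl n (v i) (v i.+1) (v j) (mx i)) => //.
      - by apply/bP; rewrite -ltnS -bn.
      - by apply/bP; rewrite bd bn.
      - by apply: le_trans ld _.
    by move/bP; rewrite -bn leqNgt exit_d.
  (* Equality would make the path revisit a vertex. *)
  have : v j.+1 != mx i.
    have ij : i < j by rewrite leq_addr.
    case: (mxE i) => ->; apply/eqP => /vinj E; move: ij.
      by rewrite -E ltnNge leqnSn.
    by rewrite -ltnS E ltnn.
  by case: ltS => _ _ tot /tot; rewrite (negbTE nlt) orbF.
have noentry y : forall i, entry i -> mx i = y -> False.
  elim/(well_founded_ind ltwf): y => y IHy i ent mxi.
  (* One entry may keep the maximum, when [v j] equals [mx i]; after two entries it is strictly
     smaller. *)
  have [j [entj jle jlt]] := next_entry _ ent.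
  have [k [entk kle klt]] := next_entry _ entj.
  apply: (IHy (mx k) _ k entk erefl); rewrite -mxi.
  case: (mxE k) => ->; first exact: le_lt_trans kle jlt.
  case: (mxE j) klt => -> klt; last exact: lt_trans klt jlt.
  have jmx := le_trans _ _ _ jle (mxr i).
  have [<-//|] := eqVneq (v j) (mx i).
  by case: ltS => _ _ tot /tot; rewrite (negbTE jmx) orbF => /(lt_trans _ _ _ klt).
(* The first exit from the block of [v 0] is an entry edge. *)
case: (ex_minnP (block_exit 0)) => e eP emin.
apply: (noentry (mx e) e _ erefl); rewrite /entry; apply: leq_trans eP.
case: e emin => [|e] emin //; rewrite ltnS leqNgt; apply/negP => /emin.
by rewrite ltnn.
Qed.

End EliminationLabeling.

(** * Bounded increasing paths and finite partitions *)

Lemma chi_star_None (V : Type) (G : graph V) :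
  chi_star G = None <-> forall k, ~ chi_star_partition G k.
Proof.
rewrite /chi_star; case: pselect => [exk|nex]; split=> //.
  by move=> nk; have [k /asboolP] := exk; have := nk k.
by move=> _ k Gk; apply: nex; exists k; apply/asboolP.
Qed.

(* The greatest [n] with [ends_path phi n x] is the length of the longest
   increasing path ending at [x]. *)
Fixpoint ends_path (V : Type) (G : graph V) (phi : V -> nat) n x : Prop :=
  if n is n'.+1 then
    exists y, [/\ adj G y x, phi y < phi x & ends_path V G phi n' y]
  else True.

Lemma ends_pathW (V : Type) (G : graph V) phi m n x :
  m <= n -> ends_path V G phi n x -> ends_path V G phi m x.
Proof.
elim: n m x => [|n IHn] [|m] x //= mn [y [yx lyx ny]].
by exists y; split=> //; apply: IHn ny.
Qed.

Lemma ends_path_increasing (V : eqType) (G : graph V) phi n x :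
  ends_path V G phi n x ->
  exists z p, increasing_path G phi z p /\ size p = n.
Proof.
suff: ends_path V G phi n x -> exists z p,
    [/\ increasing_path G phi z p, size p = n & last z p = x].
  by move=> H /H[z [p [? ? _]]]; exists z, p.
elim: n x => [|n IHn] x /=; first by exists x, [::].
move=> [y [yx lyx /IHn[z [p [[_ pG pphi] pn lastp]]]]].
have pphi' : path [rel u v | (phi u < phi v)%N] z (rcons p x).
  by rewrite rcons_path pphi lastp.
exists z, (rcons p x); split; rewrite ?last_rcons ?size_rcons ?pn //.
split=> //; last by rewrite rcons_path pG lastp.
have trphi : transitive [rel u v | (phi u < phi v)%N].
  by move=> ? ? ?; apply: ltn_trans.
by apply: (sorted_uniq trphi) => // u /=; rewrite ltnn.
Qed.

(** Along an edge the larger label has the higher class. Hence classes are independent, and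
    neighbours in lower classes have smaller labels, of which there are finitely many. *)
Lemma bounded_paths_partition (V : countType) (G : graph V) (phi : V -> nat) k :
  labeling phi ->
  ~ (exists x p, increasing_path G phi x p /\ size p = k) ->
  exists n, chi_star_partition G n.
Proof.
move=> /bij_inj phiI nopath.
have upk : exists n, `[< forall x, ~ ends_path V G phi n x >].
  by exists k; apply/asboolP => x /ends_path_increasing.
(* The least [n] is taken because [partition] demands nonempty classes. *)
case: (ex_minnP upk) => n /asboolP upn nmin; exists n.
pose F j := [set x | ends_path V G phi j x /\ ~ ends_path V G phi j.+1 x].
have Flt i j x y : F i x -> F j y -> adj G x y -> phi x < phi y -> i < j.
  move=> [xi _] [_ yj] xy lxy; rewrite ltnNge; apply/negP => ji; apply: yj.
  by apply: (@ends_pathW _ _ _ _ i.+1) => //=; exists x.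
exists F; split; first split.
- rewrite /cover; apply/seteqP; split=> // x _.
  have exj : exists j, `[< ~ ends_path V G phi j x >].
    by exists n; apply/asboolP.
  case: (ex_minnP exj) => -[/asboolP[]//|j] /asboolP xj jmin.
  have xj' : ends_path V G phi j x.
    by apply: contrapT => /asboolP/jmin; rewrite ltnn.
  exists j => //=; rewrite ltnNge; apply/negP => nj.
  exact: (upn x) (ends_pathW _ _ _ _ _ _ nj xj').
- move=> i j _ _ [x [[xi nxi] [xj nxj]]].
  apply/eqP; case: (ltngtP i j) => // ij.
    by case: nxi; apply: ends_pathW ij xj.
  by case: nxj; apply: ends_pathW ij xi.
- move=> j /= jn.
  have exx : exists m, `[< exists2 x, phi x = m & ends_path V G phi j x >].
    apply: contrapT => noex.
    suff /nmin : `[< forall x, ~ ends_path V G phi j x >] by rewrite leqNgt jn.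
    by apply/asboolP => x xj; apply: noex; exists (phi x); apply/asboolP; exists x.
  (* Among the ends of increasing paths of length [j], the one with the least label ends no longer
     path. *)
  case: (ex_minnP exx) => m /asboolP[x xm xj] mmin; exists x; split=> //.
  move=> [y [yx lyx yj]]; move: lyx; rewrite xm ltnNge => /negP; apply.
  by apply: mmin; apply/asboolP; exists y.
- move=> j jn x y xj yj; apply/negP => xy.
  case: (ltngtP (phi x) (phi y)) => [lxy|lyx|/phiI E].
  + by have := Flt _ _ _ _ xj yj xy lxy; rewrite ltnn.
  + by have := Flt _ _ _ _ yj xj; rewrite adj_sym ltnn => /(_ xy lyx).
  + by rewrite E adj_irr in xy.
- move=> j x jn xj.
  apply: (@sub_finite_set _ _ (phi @^-1` `I_(phi x))).
    move=> y [/= xy [i /= ij yi]]; case: (ltngtP (phi y) (phi x)) => // [lxy|/phiI E].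
      by have := ltn_trans ij (Flt _ _ _ _ xj yi xy lxy); rewrite ltnn.
    by move: xy; rewrite /neighbours /= E adj_irr.
  exact: finite_preimage (in2W phiI) (finite_II _).
Qed.

Lemma partition_labeling (V : countType) (G : graph V) k :
  infinite_set [set: V] -> chi_star_partition G k ->
  exists phi : V -> nat, labeling phi /\
    forall x p, increasing_path G phi x p -> size p < k.
Proof.
move=> infV [F [[Fcov _ _] Findep Ffin]].
have exc x : exists j, j < k /\ F j x.
  by have : [set: V] x by []; rewrite -Fcov => -[j]; exists j.
have [c /all_and2[ck Fc]] := choice exc.
pose R x y := adj G x y /\ c y < c x.
have finR x : finite_set [set y | R x y].
  apply: sub_finite_set (Ffin (c x) x (ck x) (Fc x)) => y [xy cyx]; split=> //.
  by exists (c y).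
have mR x y : R x y -> c y < c x by case.
have [A AP] := choice (fun x => finite_reachable _ R c x finR mR).
have exb x : exists n, `[< exists2 z, pickle z = n & A z x >].
  by exists (pickle x); apply/asboolP; exists x => //; case: (AP x).
(* The block of a vertex is the index of the first closed set [A z] containing it, so a step down in
   class never raises [b]. *)
pose b x := ex_minn (exb x).
have Rb x y : R x y -> b y <= b x.
  rewrite {2}/b; case: ex_minnP => n /asboolP[z zn Azx] _ Rxy.
  rewrite /b; case: ex_minnP => m _; apply; apply/asboolP; exists z => //.
  by case: (AP z) => _ _; apply; [exact: Azx|].
have finb n : finite_set [set x | b x <= n].
  apply: (@sub_finite_set _ _ (\bigcup_(z in pickle @^-1` `I_n.+1) A z)).
    move=> x /=; rewrite /b; case: ex_minnP => m /asboolP[z zm Azx] _ mn.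
    by exists z => //=; rewrite zm.
  apply: bigcup_finite => [|z _]; last by case: (AP z).
  apply: finite_preimage (finite_II _) => x y _ _; exact: (pcan_inj pickleK).
pose r x y := (c x < c y) || (c x == c y) && (pickle x < pickle y).
have rS : strict_total_order V r.
  split.
  - by move=> x; rewrite /r !ltnn andbF.
  - move=> y x z; rewrite /r => /orP[xy|/andP[/eqP-> xy]] /orP[yz|/andP[/eqP<- yz]].
    + by rewrite (ltn_trans xy yz).
    + by rewrite xy.
    + by rewrite yz.
    + by rewrite eqxx (ltn_trans xy yz) orbT.
  - move=> x y xy; rewrite /r; case: ltngtP => //= _.
    by rewrite -neq_ltn; apply: contra xy => /eqP /(pcan_inj pickleK) ->.
have [phi [phib phiP]] := block_labeling _ b r infV rS finb.
exists phi; split=> // x p [_ pG pphi].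
(* A neighbour of lower class lies in no later block, and [r] puts it first inside a block, so its
   label is smaller. *)
have inc y z : adj G y z -> phi y < phi z -> c y < c z.
  move=> yz lyz; case: ltngtP => // [czy|cE].
    have byz : b z <= b y by apply: Rb.
    have [|[_]] := phiP _ _ lyz; first by rewrite ltnNge byz.
    by rewrite /r ltnNge ltnW //= eq_sym ltn_eqF.
  have Fz : F (c y) z by rewrite cE.
  by have := Findep _ (ck y) y z (Fc y) Fz; rewrite yz.
(* The class rises with every edge, so [c x + size p] is at most the class of the last vertex. *)
apply: leq_ltn_trans (ck (last x p)); apply: leq_trans (leq_addl (c x) _) _.
elim: p x pG pphi => [|y p IHp] x /=; first by rewrite addn0.
move=> /andP[xy pG] /andP[lxy pphi]; apply: leq_trans (IHp y pG pphi).
by rewrite addnS -addSn leq_add2r inc.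
Qed.

(** * Subgraphs with infinite degrees, and the equivalence *)

Lemma infinite_degrees_path (V : eqType) (G : graph V) (H : subgraph G)
    (phi : V -> nat) :
  sub_verts H !=set0 -> all_degrees_infinite H -> labeling phi ->
  exists v, infinite_increasing_path G phi v.
Proof.
move=> [x0 Hx0] degH /bij_inj phiI.
have ex x : exists y, sub_verts H x -> sub_adj H x y /\ phi x < phi y.
  have [Hx|nHx] := pselect (sub_verts H x); last by exists x.
  (* Only finitely many vertices have labels at most [phi x]. *)
  apply: contrapT => noy; apply: (degH x Hx).
  apply: (@sub_finite_set _ _ (phi @^-1` `I_(phi x).+1)).
    move=> y /= xy; rewrite ltnS leqNgt; apply/negP => lxy.
    by apply: noy; exists y.
  exact: finite_preimage (in2W phiI) (finite_II _).
have [f fP] := choice ex; pose v n := iter n f x0.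
have vH n : sub_verts H (v n).
  by elim: n => // n IHn; have [fxy _] := fP _ IHn; case: (sub_adjP fxy).
have vphi n : phi (v n) < phi (v n.+1) by case: (fP _ (vH n)).
exists v; split=> // [|n]; last first.
  by have [fxy _] := fP _ (vH n); case: (sub_adjP fxy).
have vmono := homo_ltn ltn_trans vphi.
by move=> m n vmn; case: (ltngtP m n) => // /vmono; rewrite /= vmn ltnn.
Qed.

Theorem theorem3p3 (V : countType) (infV : infinite_set [set: V])
    (G : graph V) :
  FIN G <->
  chi_star G = None /\
  ~ (exists H : subgraph G, sub_verts H !=set0 /\ all_degrees_infinite H).
Proof.
rewrite chi_star_None; split.
  move=> [long [phi [phib nophi]]]; split.
    move=> k /(partition_labeling _ _ _ infV)[psi [psib psiP]].
    have [x [p [/psiP]]] := long _ psib k.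
    by move=> + pk; rewrite pk ltnn.
  by move=> [H [H0 /(infinite_degrees_path _ _ _ _ H0)/(_ phib)]].
move=> [nopart /elimination_order[lt [ltS ltwf up_fin]]]; split.
  move=> phi phib k; apply: contrapT => nopath.
  by have [n] := bounded_paths_partition _ _ _ _ phib nopath; apply: nopart.
exact: elimination_labeling ltS ltwf up_fin infV.
Qed.
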